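(* Let $\mathcal{I}$ be a nontrivial admissible ideal of subsets of $\mathbb{N}$. For any Lebesgue measurable set $H\subset\mathbb{R}$, let $\Theta_{\mathcal{I}}(H)=\{x\in\mathbb{R}:\mathcal{I}\text{-}d(x,H)\text{ exists and equals }1\}$. Then $$m\big(H\,\triangle\,\Theta_{\mathcal{I}}(H)\big)=0,$$ where $A\triangle B=(A\setminus B)\cup(B\setminus A)$.
   Context: $m$ denotes Lebesgue measure on $\mathbb{R}$. An ideal $\mathcal{I}$ of subsets of $\mathbb{N}=\{1,2,\dots\}$ is a nonempty family closed under finite unions and under subsets; it is nontrivial if $\mathcal{I}\neq\{\emptyset\}$ and $\mathbb{N}\notin\mathcal{I}$, and admissible if it contains all singletons. $\mathcal{F}(\mathcal{I})=\{M\subset\mathbb{N}:\mathbb{N}\setminus M\in\mathcal{I}\}$. For a bounded real sequence $x=(x_n)$: $\mathcal{I}\text{-}\limsup x=\sup\{b\in\mathbb{R}:\{k:x_k>b\}\notin\mathcal{I}\}$ and $\mathcal{I}\text{-}\liminf x=\inf\{a\in\mathbb{R}:\{k:x_k<a\}\notin\mathcal{I}\}$. Let $E\subset\mathbb{R}$ be Lebesgue measurable and $p\in\mathbb{R}$. Consider sequences $(J_n)_{n\in\mathbb{N}}$ of closed intervals with $p\in J_n$ for all $n$ and $\{n\in\mathbb{N}:0<m(J_n)<\frac1n\}\in\mathcal{F}(\mathcal{I})$. For such a sequence put $x_n=\frac{m(J_n\cap E)}{m(J_n)}$ (with $x_n:=0$ if $m(J_n)\in\{0,\infty\}$; such $n$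 form a set in $\mathcal{I}$ and do not matter). The upper $\mathcal{I}$-density $\mathcal{I}\text{-}d^-(p,E)$ is the supremum of $\mathcal{I}\text{-}\limsup x_n$ over all such sequences $(J_n)$, and the lower $\mathcal{I}$-density $\mathcal{I}\text{-}d_-(p,E)$ is the infimum of $\mathcal{I}\text{-}\liminf x_n$ over all such sequences. If they are equal, the common value is the $\mathcal{I}$-density $\mathcal{I}\text{-}d(p,E)$. *)

(* Defs.v *)
From HB Require Import structures.
From mathcomp Require Import all_boot all_order all_algebra.
From mathcomp Require Import all_classical all_reals all_analysis.

Set Implicit Arguments.
Unset Strict Implicit.
Unset Printing Implicit Defensive.

Import Order.TTheory GRing.Theory Num.Theory.
Import numFieldNormedType.Exports.

Local Open Scope classical_set_scope.
Local Open Scope ring_scope.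

(** The index set {1, 2, ...} is encoded by [nat], the index [n : nat] standing
    for [n.+1]; the bound 1/n thus reads [n.+1%:R^-1]. *)

Definition is_ideal (I : set (set nat)) : Prop :=
  [/\ I !=set0,
      (forall A B, I A -> I B -> I (A `|` B)) &
      (forall A B, A `<=` B -> I B -> I A)].

Definition nontrivial (I : set (set nat)) : Prop :=
  I <> [set set0] /\ ~ I setT.

Definition admissible (I : set (set nat)) : Prop :=
  forall n, I [set n].

Definition dual_filter (I : set (set nat)) : set (set nat) :=
  [set M | I (~` M)].

(** Real-valued [sup] and [inf]: for a bounded sequence and a nontrivial ideal
    the two sets below are nonempty and bounded (above, resp. below). *)
Definition ilimsup {R : realType} (I : set (set nat)) (x : nat -> R) : R :=
  sup [set b : R | ~ I [set k | b < x k]].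

Definition iliminf {R : realType} (I : set (set nat)) (x : nat -> R) : R :=
  inf [set a : R | ~ I [set k | x k < a]].

(** [lebesgue_measure] lives on the Borel sets. Lebesgue measurability is
    Caratheodory measurability for the outer measure induced by the length of
    intervals, which is the sigma-algebra of [completed_lebesgue_measure]. *)
Definition lebesgue_measurable {R : realType} (A : set R) : Prop :=
  ((@wlength R idfun)^*)%mu.-cara.-measurable A.

Notation leb := completed_lebesgue_measure.

(** Closed intervals may be degenerate or unbounded. *)
Definition admissible_intervals {R : realType} (I : set (set nat)) (p : R)
    (J : nat -> set R) : Prop :=
  [/\ (forall n, is_interval (J n) /\ closed (J n)),
      (forall n, J n p) &
      dual_filter I
        [set n | (0 < leb (J n))%E /\ (leb (J n) < (n.+1%:R^-1)%:E)%E]].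

Definition relative_measure {R : realType} (E J : set R) : R :=
  if ((0 < leb J) && (leb J < +oo))%E
  then fine (leb (J `&` E)) / fine (leb J) else 0.

Definition upper_density {R : realType} (I : set (set nat)) (p : R)
    (E : set R) : R :=
  sup [set ilimsup I (fun n => relative_measure E (J n))
      | J in admissible_intervals I p].

Definition lower_density {R : realType} (I : set (set nat)) (p : R)
    (E : set R) : R :=
  inf [set iliminf I (fun n => relative_measure E (J n))
      | J in admissible_intervals I p].

(** The density of [E] at [p] exists and equals [d]. *)
Definition has_density {R : realType} (I : set (set nat)) (p : R)
    (E : set R) (d : R) : Prop :=
  upper_density I p E = d /\ lower_density I p E = d.

Definition density_points {R : realType} (I : set (set nat)) (H : set R) :
    set R :=
  [set x | has_density I x H 1].

(* Main.v *)
Require Import Defs.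
From mathcomp Require Import all_boot all_order all_algebra.
From mathcomp Require Import all_classical all_reals all_analysis.
From mathcomp Require Import lra.
Local Open Scope classical_set_scope.
Local Open Scope ring_scope.
Import Order.TTheory GRing.Theory Num.Theory.
Import numFieldNormedType.Exports.

(** The theorem follows from Lebesgue's classical density theorem, because the
    density along an ideal agrees with the ordinary density wherever the latter
    exists with value 0 or 1.

    Call [p] a dispersion point of [A] when [A] fills a vanishing proportion of
    the balls centred at [p] as the radius tends to 0. An interval [J]
    containing [p] need not be centred at [p], but it lies in a ball of centre
    [p] whose radius is twice the length of [J], hence of comparable measure;
    so [A] also fills a vanishing proportion of the short intervals around [p]
    ([dispersion_point_interval]). In an admissible sequence of intervals all
    terms are shorter than a given bound, except for a set of indices that
    belongs to the ideal. Therefore every sequence of relative measures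
    converges to 0 along the ideal, its upper and lower limits are both 0, and
    so are the supremum and the infimum over all sequences
    ([dispersion_point_density0]). Passing to the complement, a dispersion point
    of the complement of a measurable [A] has [I]-density 1 in [A]
    ([dispersion_pointC_density1]).

    Lebesgue's theorem, applied to [H] and to its complement, says that almost
    every point outside [H] is a dispersion point of [H] and almost every point
    of [H] is a dispersion point of the complement ([ae_dispersion_point]).
    Outside the two exceptional null sets, [H] and its set of density points
    coincide, and completeness of the measure makes their symmetric difference
    measurable. *)

(** * Limits along an ideal *)

Definition icvg {R : realType} (I : set (set nat)) (x : nat -> R) (l : R) :=
  forall e, 0 < e -> I [set k | e <= `|x k - l|].

Lemma sup_of_cut {R : realType} (S : set R) (l : R) :
  (forall b, b < l -> S b) -> (forall b, l < b -> ~ S b) -> sup S = l.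
Proof.
move=> Slt Sgt.
have ubS : ubound S l by move=> b Sb; rewrite leNgt; apply/negP => /Sgt.
have S0 : S !=set0 by exists (l - 1); apply: Slt; lra.
apply/eqP; rewrite eq_le ge_sup//= leNgt; apply/negP => supl.
have : S ((sup S + l) / 2) by apply: Slt; lra.
by move=> /ub_le_sup => /(_ (ex_intro _ l ubS)); lra.
Qed.

(** Reflection lets results on the lower limit be read off from those on the
    upper limit. *)
Lemma iliminfE {R : realType} (I : set (set nat)) (x : nat -> R) :
  iliminf I x = - ilimsup I (fun n => - x n).
Proof.
rewrite /iliminf /inf /ilimsup; congr (- sup _).
apply/seteqP; split=> [_ [a Ia <-]|b Ib] /=.
  by under eq_set do rewrite ltrN2.
by exists (- b); rewrite ?opprK//=; under eq_set do rewrite ltrNr.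
Qed.

Section ideal.
Context {R : realType} {I : set (set nat)}.
Hypotheses (hI : is_ideal I) (hnontriv : nontrivial I) (hadm : admissible I).

Lemma idealU {A B} : I A -> I B -> I (A `|` B).
Proof. by case: hI => _ + _; apply. Qed.

Lemma idealS {A B} : A `<=` B -> I B -> I A.
Proof. by case: hI => _ _; apply. Qed.

(** This is how admissibility enters: conditions that hold for all large
    indices hold along the ideal. *)
Lemma ideal_initial N : I [set k | (k < N)%N].
Proof.
elim: N => [|N IH]; first exact: idealS (hadm 0).
apply: idealS (idealU IH (hadm N)) => k /=.
by rewrite ltnS leq_eqVlt => /predU1P[->|]; [right|left].
Qed.

(** For [b] below the limit, [{k | b < x k}] and an exceptional set of the
    ideal cover all indices, so the former cannot belong to a nontrivial ideal;
    for [b] above the limit it is itself contained in an exceptional set. *)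
Lemma icvg_ilimsup {x : nat -> R} {l} : icvg I x l -> ilimsup I x = l.
Proof.
move=> xl; apply: sup_of_cut => b bl /=.
- move=> Ib; case: hnontriv => _; apply.
  have e0 : 0 < l - b by lra.
  apply: idealS (idealU Ib (xl _ e0)) => k _ /=.
  have [|kb] := ltP b (x k); first by left.
  by right; rewrite ler_normr; lra.
- apply; apply: idealS (xl (b - l) _) => [k /=|]; last by lra.
  by rewrite ler_normr; lra.
Qed.

Lemma icvg_iliminf {x : nat -> R} {l} : icvg I x l -> iliminf I x = l.
Proof.
move=> xl; rewrite iliminfE (_ : ilimsup _ _ = - l) ?opprK//.
apply: icvg_ilimsup => e /xl; apply: idealS => k /=.
by rewrite -opprD normrN.
Qed.

End ideal.

(** * Intervals shrinking to a point *)

(** The classical notion of a point of density 0. The bound uses [r] in place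
    of the measure [r *+ 2] of the ball, which only rescales [e] and avoids
    dividing in the extended reals. *)
Definition dispersion_point {R : realType} (A : set R) (p : R) :=
  forall e, 0 < e ->
    \forall r \near 0^'+, (leb (A `&` ball p r) <= (e * r)%:E)%E.

(** Both measures are the outer measure induced by the length of intervals, and
    differ only in the sigma-algebra they are attached to. *)
Lemma lebE {R : realType} (A : set R) : leb A = lebesgue_measure A.
Proof. by []. Qed.

Lemma le_leb {R : realType} (A B : set R) : A `<=` B -> (leb A <= leb B)%E.
Proof. exact: (le_outer_measure (@wlength R idfun)^*%mu). Qed.

Lemma leb_ge0 {R : realType} (A : set R) : (0 <= leb A)%E.
Proof. exact: (outer_measure_ge0 (@wlength R idfun)^*%mu). Qed.

Lemma leb_setI_fin_num {R : realType} {J : set R} (A : set R) :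
  (leb J < +oo)%E -> leb (J `&` A) \is a fin_num.
Proof.
move=> Joo; rewrite ge0_fin_numE ?leb_ge0//; apply: le_lt_trans Joo.
by apply: le_leb => ? [].
Qed.

Lemma leb_itv_le {R : realType} (a b : R) : a <= b -> leb `[a, b] = (b - a)%:E.
Proof.
move=> ab; rewrite lebE lebesgue_measure_itv/= lte_fin -EFinB.
by case: ltgtP ab => // -> _; rewrite subrr.
Qed.

(** The segment from [p] to a point of [J] lies in [J], so it is no longer than
    the measure of [J]. The factor 2 makes room for an open ball. *)
Lemma interval_sub_ball {R : realType} {J : set R} {p l : R} :
  is_interval J -> J p -> leb J = l%:E -> 0 < l -> J `<=` ball p (2 * l).
Proof.
move=> iJ Jp Jl l0 y Jy; rewrite /ball/=.
suff : `|p - y| <= l by lra.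
have sub a b : J a -> J b -> a <= b -> b - a <= l.
  move=> Ja Jb ab; rewrite -lee_fin -Jl -leb_itv_le//; apply: le_leb => z /=.
  by rewrite in_itv/=; exact: iJ.
have [py|/ltW yp] := leP p y; first by rewrite distrC ger0_norm ?subr_ge0// sub.
by rewrite ger0_norm ?subr_ge0// sub.
Qed.

(** An interval [J] of length [l] around [p] sits in the ball of radius
    [2 * l], on which [A] has measure at most [e / 2 * (2 * l) = e * l]. *)
Lemma dispersion_point_interval {R : realType} {A : set R} {p e} :
  dispersion_point A p -> 0 < e ->
  exists2 d, 0 < d & forall J, is_interval J -> J p ->
    (0 < leb J)%E -> (leb J < d%:E)%E -> `|relative_measure A J| <= e.
Proof.
move=> Ap e0; have [|d /= d0 Ad] := Ap (e / 2); first by lra.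
exists (d / 2); first by lra.
move=> J iJ Jp J0 Jd.
have Joo : (leb J < +oo)%E by rewrite (lt_trans Jd) ?ltry.
have Jfin : leb J \is a fin_num by rewrite ge0_fin_numE ?leb_ge0.
rewrite /relative_measure J0 Joo/=.
set l := fine (leb J).
have Jl : leb J = l%:E by rewrite fineK.
have l0 : 0 < l by rewrite -lte_fin -Jl.
rewrite ger0_norm; last first.
  by apply: divr_ge0; [exact: fine_ge0 (leb_ge0 _)|exact: ltW].
rewrite ler_pdivrMr// -lee_fin fineK ?leb_setI_fin_num//.
rewrite Jl lte_fin in Jd.
have := Ad (2 * l).
rewrite /ball_/= sub0r normrN gtr0_norm; last by lra.
move=> /(_ ltac:(lra) ltac:(lra)).
rewrite (_ : e / 2 * (2 * l) = e * l); last by lra.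
apply: le_trans; apply: le_leb => z [Jz Az]; split => //.
exact: interval_sub_ball Jl l0 _ Jz.
Qed.

Lemma relative_measureC {R : realType} (A J : set R) :
  lebesgue_measurable A -> (0 < leb J)%E -> (leb J < +oo)%E ->
  relative_measure A J = 1 - relative_measure (~` A) J.
Proof.
move=> mA J0 Joo; rewrite /relative_measure J0 Joo/=.
have fin := leb_setI_fin_num ^~ Joo.
(* The Caratheodory criterion for A, tested on J. *)
have JE : leb J = (leb (J `&` A) + leb (J `&` ~` A))%E by exact: mA.
have l0 : 0 < fine (leb J) by rewrite fine_gt0// J0 Joo.
rewrite -[1](divff (lt0r_neq0 l0)) -mulrBl [in X in X - _]JE.
by rewrite fineD// addrK.
Qed.

(** * Density along the ideal *)

Section density.
Context {R : realType} {I : set (set nat)}.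
Hypotheses (hI : is_ideal I) (hnontriv : nontrivial I) (hadm : admissible I).

(** Without a sequence to take them over, the supremum and the infimum defining
    the densities would be default values. *)
Lemma admissible_intervals_nonempty (p : R) : admissible_intervals I p !=set0.
Proof.
have [h h0 hlt] : exists2 h : nat -> R, (forall n, 0 < h n) &
    (forall n, h n < n.+1%:R^-1).
  exists (fun n => n.+1%:R^-1 / 2) => n; first by rewrite divr_gt0.
  by rewrite ltr_pdivrMr// ltr_pMr ?ltr1n.
exists (fun n => `[p, p + h n]%classic); split.
- by move=> n; split; [exact: interval_is_interval|exact: interval_closed].
- by move=> n; rewrite /= in_itv/= lexx/= lerDl ltW.
- apply: (idealS hI) _ (hadm 0%N) => // n /= [].
  by rewrite leb_itv_le ?lerDl ?(ltW (h0 n))// addrC addKr !lte_fin.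
Qed.

Lemma icvg_has_density (p : R) E l :
  (forall J, admissible_intervals I p J ->
    icvg I (fun n => relative_measure E (J n)) l) -> has_density I p E l.
Proof.
move=> El; have [J0 hJ0] := admissible_intervals_nonempty p.
have img (f : (nat -> set R) -> R) :
    (forall J, admissible_intervals I p J -> f J = l) ->
    [set f J | J in admissible_intervals I p] = [set l].
  move=> fl; apply/seteqP; split=> [_ [J hJ <-]|_ ->]; first exact: fl.
  by exists J0; rewrite ?fl.
split.
- rewrite /upper_density img ?sup1// => J /El; exact: icvg_ilimsup.
- rewrite /lower_density img ?inf1// => J /El; exact: icvg_iliminf.
Qed.

(** The lengths tend to 0 along the ideal: the index [n] is bad only if the
    constraint [leb (J n) < n.+1%:R^-1] fails, which happens on a set of the
    ideal, or if [n.+1%:R^-1] has not yet dropped below [d], which happens for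
    finitely many [n]. *)
Lemma admissible_intervals_small {p d : R} {J} : 0 < d ->
  admissible_intervals I p J ->
  I [set n | ~ (0 < leb (J n) /\ leb (J n) < d%:E)%E].
Proof.
move=> d0 [_ _ IJ].
have [N Nd] : exists N, forall n, (N <= n)%N -> n.+1%:R^-1 < d.
  have [N _ Nd] := near_infty_natSinv_lt (PosNum d0).
  by exists N => n /Nd.
apply: (idealS hI) _ (idealU hI IJ (ideal_initial hI hadm N)) => //= n nJ.
have [|Nn] := ltnP n N; first by right.
by left=> -[J0 Jn]; apply: nJ; split => //; rewrite (lt_trans Jn)// lte_fin Nd.
Qed.

Lemma dispersion_point_density0 {A : set R} {p} :
  dispersion_point A p -> has_density I p A 0.
Proof.
move=> Ap; apply: icvg_has_density => J hJ e e0.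
have [|d d0 Ad] := dispersion_point_interval (e := e / 2) Ap; first by lra.
apply: (idealS hI) _ (admissible_intervals_small d0 hJ) => // n /= + [Jn0 Jnd].
case: hJ => /(_ n)[iJ _] /(_ n) Jp _.
by have := Ad _ iJ Jp Jn0 Jnd; rewrite subr0; lra.
Qed.

(** Measurability of [A] is what turns smallness of the complement in [J] into
    [A] filling most of [J]. *)
Lemma dispersion_pointC_density1 (A : set R) p : lebesgue_measurable A ->
  dispersion_point (~` A) p -> has_density I p A 1.
Proof.
move=> mA Ap; apply: icvg_has_density => J hJ e e0.
have [|d d0 Ad] := dispersion_point_interval (e := e / 2) Ap; first by lra.
apply: (idealS hI) _ (admissible_intervals_small d0 hJ) => // n /= + [Jn0 Jnd].
case: hJ => /(_ n)[iJ _] /(_ n) Jp _.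
have := Ad _ iJ Jp Jn0 Jnd.
rewrite (relative_measureC A) ?(lt_trans Jnd) ?ltry//.
by rewrite addrAC subrr sub0r normrN; lra.
Qed.

End density.

(** * Almost every point outside a measurable set is a dispersion point *)

Lemma lebesgue_measurable_borel {R : realType} {A : set R} :
  lebesgue_measurable A -> exists B N : set R,
  [/\ measurable (B : set (measurableTypeR R)),
      lebesgue_measure.-negligible N & A = B `|` N].
Proof.
rewrite /lebesgue_measurable -completed_caratheodory_measurable.
rewrite g_sigma_completed_algebra_genE => -[B mB [N hN <-]].
by exists B, N.
Qed.

Lemma negligible_leb {R : realType} {N : set R} :
  (@lebesgue_measure R).-negligible N -> leb N = 0%E.
Proof.
move=> [M [_ M0 NM]]; apply/eqP.
by rewrite eq_le leb_ge0 andbT -M0; exact: le_leb.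
Qed.

(** Lebesgue's density theorem concerns Borel sets; a Lebesgue measurable set is
    a Borel set [B] up to a null set, and a null set changes no measure. The
    points of density 1 are reached by applying this to the complement. *)
Lemma ae_dispersion_point {R : realType} {A : set R} : lebesgue_measurable A ->
  {ae lebesgue_measure, forall p, ~ A p -> dispersion_point A p}.
Proof.
move=> /lebesgue_measurable_borel[B [N [mB /negligible_leb N0 ->]]].
have := lebesgue_density mB.
apply: filter_app; first exact: (ae_filter_ringOfSetsType (@lebesgue_measure R)).
apply: aeW => /= p Bp /not_orP[nBp _] e e0.
move: Bp; rewrite indicE memNset//= => /fine_cvgP[Bfin /cvgrPdist_le Bp].
have e20 : 0 < e / 2 by lra.
have {}Bp := Bp (e / 2) e20.
near=> r.
have r0 : 0 < r by near: r; exact: nbhs_right_gt.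
have Br : (lebesgue_measure (B `&` ball p r) *
    (lebesgue_measure (ball p r))^-1 <= (e / 2)%:E)%E.
  rewrite -[leLHS]fineK; last by near: r.
  rewrite lee_fin (le_trans (ler_norm _))// -normrN -sub0r.
  by near: r.
rewrite setIUl.
apply: (@le_trans _ _ (leb (B `&` ball p r) + leb (N `&` ball p r))%E).
  exact: (outer_measureU2 (@wlength R idfun)^*%mu).
have -> : leb (N `&` ball p r) = 0%E.
  by apply/eqP; rewrite eq_le leb_ge0 andbT -N0; apply: le_leb => ? [].
rewrite adde0.
move: Br; rewrite (lebesgue_measure_ball _ (ltW r0)).
rewrite inver mulrn_eq0/= gt_eqF// lee_pdivrMr ?pmulrn_lgt0// -EFinM.
by rewrite (_ : e / 2 * (r *+ 2) = e * r)//; lra.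
Unshelve. all: by end_near. Qed.

Theorem theorem3p2 (R : realType) (I : set (set nat)) (hI : is_ideal I)
    (hnontriv : nontrivial I) (hadm : admissible I)
    (H : set R) (hH : lebesgue_measurable H) :
  lebesgue_measurable (H `+` density_points I H) /\
  completed_lebesgue_measure (H `+` density_points I H) = 0%E.
Proof.
(* A null set is measurable, being the union of an empty Borel set and a
   negligible set. *)
suff neg : (@lebesgue_measure R).-negligible (H `+` density_points I H).
  split; last exact: negligible_leb.
  rewrite /lebesgue_measurable -completed_caratheodory_measurable.
  apply: sub_sigma_algebra; exists set0 => //.
  by exists (H `+` density_points I H); rewrite ?set0U.
have hHC : lebesgue_measurable (~` H) by exact: measurableC.
apply: negligibleS (negligibleU (ae_dispersion_point hH)
  (ae_dispersion_point hHC)).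
(* A point of H that is not a density point is exceptional for the complement
   of H; a density point outside H cannot have density 0, so it is exceptional
   for H. *)
move=> p /= [[Hp nTp]|[Tp nHp]].
- right=> /(_ (fun nHp => nHp Hp)) Hd; apply: nTp.
  exact: dispersion_pointC_density1.
- left=> /(_ nHp) Hd.
  have [H0 _] := dispersion_point_density0 hI hnontriv hadm Hd.
  by case: Tp => + _; rewrite H0; lra.
Qed.
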